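(* Let $\boldsymbol\xi=(\xi_1,\dots,\xi_n)$ be the indicator vector of the output of binary-tree pivotal sampling on a fixed full binary tree $T$ with leaves $[n]$ and leaf probabilities $q_1,\dots,q_n\in[0,1]$ with integer sum. Let $\mathcal S\subseteq[n]$ with $\Pr[\xi_\ell=1\ \forall\ell\in\mathcal S]>0$. Then the conditional distribution of $(\xi_j)_{j\in[n]\setminus\mathcal S}$ given $\{\xi_\ell=1\ \forall\ell\in\mathcal S\}$ is the joint distribution obtained by running binary-tree pivotal sampling independently on finitely many full binary trees whose leaf sets partition $[n]\setminus\mathcal S$, with suitable leaf probabilities.
   Context: Binary-tree pivotal sampling: let $T$ be a full binary tree whose leaves are identified with an index set, and let $q_i\in[0,1]$ be leaf probabilities with integer sum. Each node can store an index together with a current probability; initially each leaf $i$ stores $i$ with probability $q_i$, and the output set $\mathcal S_{\rm out}$ is empty. Repeatedly choose two sibling nodes that both store indices, say $i$ with probability $q_i$ and $j$ with probability $q_j$, with parent $P$, and remove them. If $q_i+q_j\le1$: with probability $q_i/(q_i+q_j)$ store $i$ at $P$ with probability $q_i+q_j$ ($j$ is rejected), otherwise store $j$ at $P$ with probability $q_i+q_j$ ($i$ is rejected). If $q_i+q_j>1$: with probability $(1-q_i)/(2-q_i-q_j)$ put $j$ into $\mathcal S_{\rm out}$ and store $i$ at $P$ with probability $q_i+q_j-1$; otherwise put $i$ into $\mathcal S_{\rm out}$ and store $j$ at $P$ with probability $q_i+q_j-1$. When only the root stores an index, put it into $\mathcal S_{\rm out}$ iff its probability is $1$. *)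

(* Defs.v *)
From HB Require Import structures.
From mathcomp Require Import all_boot all_order all_algebra.
From mathcomp Require Import reals.
From Stdlib Require List.

Set Implicit Arguments.
Unset Strict Implicit.
Unset Printing Implicit Defensive.

Import Order.TTheory GRing.Theory Num.Theory.
Local Open Scope ring_scope.

Inductive tree (I : Type) : Type :=
  | Leaf of I
  | Node of tree I & tree I.

Arguments Leaf {I} _.
Arguments Node {I} _ _.

Fixpoint leaves (I : Type) (t : tree I) : seq I :=
  match t with
  | Leaf i => [:: i]
  | Node l r => leaves l ++ leaves r
  end.

Section Pivotal.
Variables (R : realType) (n : nat).

(* A state of a node: (stored index, its current probability, output set so
   far from the subtree). A (finite) distribution is a list of weighted
   states (weight, state). *)
Definition state := ('I_n * R * {set 'I_n})%type.

Definition merge (s1 s2 : state) : seq (R * state) :=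
  let: (i, a, X1) := s1 in
  let: (j, b, X2) := s2 in
  let X := X1 :|: X2 in
  if a + b <= 1 then
    let p := a / (a + b) in
    [:: (p, (i, a + b, X)); (1 - p, (j, a + b, X))]
  else
    let p := (1 - a) / (2 - a - b) in
    [:: (p, (i, a + b - 1, j |: X)); (1 - p, (j, a + b - 1, i |: X))].

Fixpoint pivotal_run (q : 'I_n -> R) (t : tree 'I_n) : seq (R * state) :=
  match t with
  | Leaf i => [:: (1, (i, q i, set0))]
  | Node l r =>
      flatten [seq [seq (x1.1 * x2.1 * y.1, y.2) | y <- merge x1.2 x2.2]
              | x1 <- pivotal_run q l, x2 <- pivotal_run q r]
  end.

Definition pivotal_out (q : 'I_n -> R) (t : tree 'I_n) : seq (R * {set 'I_n}) :=
  map (fun x : R * state =>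
         (x.1, let: (i, a, X) := x.2 in if a == 1 then i |: X else X))
      (pivotal_run q t).

Definition pivotal_prob (q : 'I_n -> R) (t : tree 'I_n)
    (P : pred {set 'I_n}) : R :=
  \sum_(x <- pivotal_out q t | P x.2) x.1.

Definition valid_leaf_probs (q : 'I_n -> R) (t : tree 'I_n) : Prop :=
  (forall i, i \in leaves t -> 0 <= q i <= 1) /\
  exists k : nat, \sum_(i <- leaves t) q i = k%:R.

End Pivotal.

(* Main.v *)
Require Import Defs.
From HB Require Import structures.
From mathcomp Require Import all_boot all_order all_algebra.
From mathcomp Require Import reals.
From mathcomp Require Import zify ring lra.
From Stdlib Require List.
Import Order.TTheory GRing.Theory Num.Theory.
Local Open Scope ring_scope.

(** Whether the index pending at a node is eventually accepted depends only on
    the process above that node, so a subtree enters the rest only through its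
    two outcome generating functions, "pending index rejected" and "pending
    index accepted". At a node these are [D_o l * D_o r] and a convex
    combination of [D_~o l * D_o r] and [D_o l * D_~o r]. Conditioning on
    [S] preserves this shape: a pending index of [S] is forced to be accepted,
    which either turns the sibling into a subtree with a decided outcome or
    leaves the sibling's pending index as the only one, with rescaled weights.
    Conversely, the mixing weights of a tree do not determine its root
    probability: leaf probabilities with the same mixing weights exist for any
    root probability in ]0,1[, and a decided outcome is a product of trees with
    integer sums. *)

(** * Skeletons: step kinds and mixing weights, without leaf probabilities *)

Section Skeletons.
Context {R : realFieldType} {I : eqType}.

Inductive skeleton : Type :=
  | SLeaf of I
  | SNode of bool & R & skeleton & skeleton.

Fixpoint sleaves (U : skeleton) : seq I :=
  match U with
  | SLeaf i => [:: i]
  | SNode _ _ l r => sleaves l ++ sleaves r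
  end.

Fixpoint all_weights (P : pred R) (U : skeleton) : bool :=
  match U with
  | SLeaf _ => true
  | SNode _ p l r => [&& P p, all_weights P l & all_weights P r]
  end.

(* [x true i] (resp. [x false i]) marks that [i] is in (resp. not in) the output;
   [b] tells whether the index pending at the root is accepted. The node kind [o]
   is [true] when the two probabilities sum to more than 1, i.e. when the index
   that is not passed on is output. *)
Fixpoint genfun (x : bool -> I -> R) (U : skeleton) (b : bool) : R :=
  match U with
  | SLeaf i => x b i
  | SNode o p l r =>
      if b == o then genfun x l o * genfun x r o
      else p * (genfun x l (~~ o) * genfun x r o)
           + (1 - p) * (genfun x l o * genfun x r (~~ o))
  end.

(** The weights [p] and [1 - p] add up to 1. This total mass later identifies the normalizing
    constant. *)
Lemma genfun1 (x : bool -> I -> R) (U : skeleton) (b : bool) :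
  (forall b' i, i \in sleaves U -> x b' i = 1) -> genfun x U b = 1.
Proof.
elim: U b => [i|o p l IHl r IHr] b x1 /=; first by rewrite x1 ?mem_head.
have xl b' i : i \in sleaves l -> x b' i = 1.
  by move=> il; rewrite x1 //= mem_cat il.
have xr b' i : i \in sleaves r -> x b' i = 1.
  by move=> ir; rewrite x1 //= mem_cat ir orbT.
rewrite !IHl // !IHr //; case: ifP => _; ring.
Qed.

Definition prob_weight (p : R) := 0 <= p <= 1.
(** Strictness lets [realize_skeleton] keep every node probability strictly between 0 and 1. *)
Definition proper_weight (p : R) := 0 < p < 1.

(** * Conditioning on accepted indices *)

Definition oleaves (U : option skeleton) := oapp sleaves [::] U.
(* [None] stands for a subtree whose pending index belongs to the conditioning
   set, so that rejecting it has probability 0. *)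
Definition ogenfun (x : bool -> I -> R) (U : option skeleton) (b : bool) : R :=
  oapp (fun V => genfun x V b) b%:R U.
Definition oproper (U : option skeleton) := oapp (all_weights proper_weight) true U.

(** The boolean is the outcome imposed at the root of the skeleton. *)
Definition forest := seq (bool * skeleton).
Definition fleaves (F : forest) := flatten [seq sleaves f.2 | f <- F].
Definition fgenfun (x : bool -> I -> R) (F : forest) : R :=
  \prod_(f <- F) genfun x f.2 f.1.
Definition fproper (F : forest) := all (fun f => all_weights proper_weight f.2) F.

Lemma fgenfun1 (x : bool -> I -> R) (F : forest) :
  (forall b i, i \in fleaves F -> x b i = 1) -> fgenfun x F = 1.
Proof.
rewrite /fgenfun /fleaves; elim: F => [|f F IH] x1; first by rewrite big_nil.
rewrite big_cons IH ?genfun1 ?mulr1 // => b i iF.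
  by rewrite x1 //= mem_cat iF.
by rewrite x1 //= mem_cat iF orbT.
Qed.

(* A zero mixing weight decides the outcome of one of the two subtrees, which then
   splits off into the forest. *)
Lemma merge_conditioned (o : bool) (w u v : R) (U1 U2 : option skeleton) :
  0 <= w -> 0 <= u -> 0 <= v -> oproper U1 -> oproper U2 ->
  exists (F : forest) (U : option skeleton) (e : bool -> R),
    [/\ fproper F, oproper U, forall b, 0 <= e b,
        perm_eq (fleaves F ++ oleaves U) (oleaves U1 ++ oleaves U2) &
        forall x b,
          (if b == o then w * (ogenfun x U1 o * ogenfun x U2 o)
           else u * (ogenfun x U1 (~~ o) * ogenfun x U2 o)
                + v * (ogenfun x U1 o * ogenfun x U2 (~~ o)))
          = e b * (fgenfun x F * ogenfun x U b)].
Proof.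
move=> w0 u0 v0.
pose e (y : R) b := if b == o then w else y.
have e0 y : 0 <= y -> forall b, 0 <= e y b.
  by move=> y0 b; rewrite /e; case: ifP.
have nE b : b == o = false -> b = ~~ o by case: b; case: (o).
case: U1 => [A|]; case: U2 => [B|] /= wA wB.
- have [u_eq0|u_neq0] := eqVneq u 0.
    exists [:: (o, A)], (Some B), (e v).
    split=> //=; [by rewrite /fproper /= wA | exact: e0 | by rewrite /fleaves /= !cats0 |].
    move=> x b; rewrite /e /fgenfun big_seq1 /=.
    case: ifPn => [/eqP->|/negbTE/nE->] //.
    by rewrite u_eq0 mul0r add0r.
  have [v_eq0|v_neq0] := eqVneq v 0.
    exists [:: (o, B)], (Some A), (e u).
    split=> //=; [by rewrite /fproper /= wB | exact: e0 | by rewrite /fleaves /= cats0 perm_catC |].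
    move=> x b; rewrite /e /fgenfun big_seq1 /=.
    case: ifPn => [/eqP->|/negbTE/nE->]; first ring.
    rewrite v_eq0; ring.
  have up : 0 < u by rewrite lt_def u_neq0.
  have vp : 0 < v by rewrite lt_def v_neq0.
  have uvp : 0 < u + v by rewrite addr_gt0.
  (* The coefficients [u] and [v] need not sum to 1: their sum goes into the constant, their shares
     become the new weight. *)
  exists [::], (Some (SNode o (u / (u + v)) A B)), (e (u + v)).
  split=> //=; [| by apply: e0; exact: ltW |].
    rewrite wA wB !andbT /proper_weight divr_gt0 //= ltr_pdivrMr // mul1r.
    by rewrite ltrDl.
  move=> x b; rewrite /e /fgenfun big_nil mul1r.
  case: ifP => // _; field; exact: lt0r_neq0.
(* The [None] index must be accepted. If [o = false], it has to be passed on and the index of [A] is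
   rejected; if [o = true], the outcome of the node is that of [A]. *)
- case: (o) nE @e e0 => nE e e0; last first.
    exists [:: (false, A)], None, (fun b => if b then v else 0).
    split=> //=; [by rewrite /fproper /= wA | by case | by rewrite /fleaves /= !cats0 |].
    by move=> x [] /=; rewrite /fgenfun big_seq1 /=; ring.
  exists [::], (Some A), (e u).
  split=> //=; [exact: e0 | by rewrite cats0 |].
  by move=> x [] /=; rewrite /e /fgenfun big_nil /=; ring.
- case: (o) nE @e e0 => nE e e0; last first.
    exists [:: (false, B)], None, (fun b => if b then u else 0).
    split=> //=; [by rewrite /fproper /= wB | by case | by rewrite /fleaves /= !cats0 |].
    by move=> x [] /=; rewrite /fgenfun big_seq1 /=; ring.
  exists [::], (Some B), (e v).
  split=> //=; [exact: e0 |].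
  by move=> x [] /=; rewrite /e /fgenfun big_nil /=; ring.
- exists [::], None, (fun b => if o && b then w else 0).
  split=> //=; first by move=> b; case: ifP.
  by move=> x [] /=; rewrite /fgenfun big_nil; case: (o) => /=; ring.
Qed.

Lemma fleaves_cat (F G : forest) : fleaves (F ++ G) = fleaves F ++ fleaves G.
Proof. by rewrite /fleaves map_cat flatten_cat. Qed.

Lemma fgenfun_cat x (F G : forest) : fgenfun x (F ++ G) = fgenfun x F * fgenfun x G.
Proof. exact: big_cat. Qed.

Definition conditioned_on (S : pred I) (x : bool -> I -> R) :=
  forall i, S i -> forall b, x b i = b%:R.

(** The constant depends on the outcome [b] but not on [x], so it cancels in a quotient of
    probabilities. *)
Lemma condition_skeleton (S : pred I) (U : skeleton) :
  all_weights prob_weight U ->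
  exists (F : forest) (V : option skeleton) (c : bool -> R),
    [/\ fproper F, oproper V, forall b, 0 <= c b,
        perm_eq (fleaves F ++ oleaves V) [seq i <- sleaves U | ~~ S i] &
        forall x, conditioned_on S x -> forall b,
          genfun x U b = c b * (fgenfun x F * ogenfun x V b)].
Proof.
elim: U => [i|o p l IHl r IHr] /=.
  move=> _; case: ifPn => [Si|Si]; [exists [::], (Some (SLeaf i)), (fun=> 1)
                         | exists [::], None, (fun=> 1)];
  split=> //= x xS b; rewrite /fgenfun big_nil !mul1r // xS //.
  exact: negbNE.
case/and3P=> /andP[p0 p1] /IHl[F1 [V1 [c [F1p V1p c0 perm1 g1]]]].
case/IHr=> F2 [V2 [d [F2p V2p d0 perm2 g2]]].
(* The constants of both subtrees are absorbed into the coefficients of the node. *)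
have [] := @merge_conditioned o (c o * d o) (p * (c (~~ o) * d o))
  ((1 - p) * (c o * d (~~ o))) V1 V2; rewrite ?mulr_ge0 ?subr_ge0 //.
move=> F [V [e [Fp Vp e0 perm12 g12]]].
exists (F1 ++ F2 ++ F), V, e; split=> //.
- by move: F1p F2p Fp; rewrite /fproper !all_cat => -> ->.
- rewrite !fleaves_cat filter_cat; apply/permP => a.
  move/permP/(_ a): perm1; move/permP/(_ a): perm2; move/permP/(_ a): perm12.
  rewrite !count_cat; lia.
- move=> x xS b; rewrite !g1 // !g2 // !fgenfun_cat.
  transitivity (fgenfun x F1 * fgenfun x F2 * (e b * (fgenfun x F * ogenfun x V b))).
    rewrite -g12; case: ifP => _; ring.
  ring.
Qed.

End Skeletons.

(** * Trees with leaf probabilities, and realization of skeletons *)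

Fixpoint tree_map {A B : Type} (f : A -> B) (t : tree A) : tree B :=
  match t with
  | Leaf a => Leaf (f a)
  | Node l r => Node (tree_map f l) (tree_map f r)
  end.

Lemma leaves_tree_map {A B : Type} (f : A -> B) t :
  leaves (tree_map f t) = map f (leaves t).
Proof. by elim: t => //= l -> r ->; rewrite map_cat. Qed.

Lemma tree_map_comp_id {A : eqType} {B : Type} (f : A -> B) (g : B -> A) t :
  {in leaves t, cancel f g} -> tree_map g (tree_map f t) = t.
Proof.
elim: t => [a|l IHl r IHr] /= fK; first by rewrite fK ?mem_head.
rewrite IHl ?IHr // => a al; apply: fK; by rewrite mem_cat al ?orbT.
Qed.

Section WeightedTrees.
Context {R : realFieldType} {I : eqType}.
Implicit Types d : tree (I * R).

(** The index stored at a node is random, but its probability is the same in every run. *)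
Fixpoint root_prob d : R :=
  match d with
  | Leaf y => y.2
  | Node l r =>
      let s := root_prob l + root_prob r in if s <= 1 then s else s - 1
  end.

Definition win_prob (a b : R) : R :=
  if a + b <= 1 then a / (a + b) else (1 - a) / (2 - a - b).

Fixpoint skeleton_of d : skeleton (R := R) (I := I) :=
  match d with
  | Leaf y => SLeaf y.1
  | Node l r =>
      SNode (~~ (root_prob l + root_prob r <= 1))
        (win_prob (root_prob l) (root_prob r)) (skeleton_of l) (skeleton_of r)
  end.

Definition leaf_probs_ok d := all (fun y => 0 <= y.2 <= 1) (leaves d).

Definition leaf_sum d : R := \sum_(y <- leaves d) y.2.

Definition valid_tree d := leaf_probs_ok d /\ exists k : nat, leaf_sum d = k%:R.

Lemma leaf_sum_node l r : leaf_sum (Node l r) = leaf_sum l + leaf_sum r.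
Proof. exact: big_cat. Qed.

Lemma sleaves_skeleton_of d : sleaves (skeleton_of d) = map fst (leaves d).
Proof. by elim: d => //= l -> r ->; rewrite map_cat. Qed.

Lemma win_prob_weight a b :
  0 <= a <= 1 -> 0 <= b <= 1 -> prob_weight (win_prob a b).
Proof.
move=> /andP[a0 a1] /andP[b0 b1]; rewrite /prob_weight /win_prob.
have ratio (y z : R) : 0 <= y -> 0 <= z -> 0 <= y / (y + z) <= 1.
  move=> y0 z0; rewrite divr_ge0 ?addr_ge0 //=.
  (* Siblings both of probability 0, or both of probability 1, give [0 / 0], which is 0 by
     convention. *)
  have [->|yz] := eqVneq (y + z) 0; first by rewrite invr0 mulr0.
  by rewrite ler_pdivrMr ?mul1r ?lerDl // lt_def yz addr_ge0.
case: ifP => _; first exact: ratio.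
have -> : 2 - a - b = (1 - a) + (1 - b) by ring.
by apply: ratio; rewrite subr_ge0.
Qed.

Lemma skeleton_of_weights d : leaf_probs_ok d ->
  0 <= root_prob d <= 1 /\ all_weights prob_weight (skeleton_of d).
Proof.
rewrite /leaf_probs_ok; elim: d => [y|l IHl r IHr] /=; first by rewrite andbT.
rewrite all_cat => /andP[/IHl[al wl] /IHr[ar wr]].
rewrite wl wr win_prob_weight //; split=> //.
by case: ifP => h; lra.
Qed.

(** Top-down construction: [t] is split into child probabilities in []0, 1[] that produce the
    prescribed kind and weight. Each node of kind [true] outputs one index, adding 1 to the leaf
    sum. *)
Lemma realize_skeleton (U : skeleton) (t : R) :
  all_weights proper_weight U -> 0 < t < 1 ->
  exists d, [/\ skeleton_of d = U, root_prob d = t, leaf_probs_ok d &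
               exists k : nat, leaf_sum d = k%:R + t].
Proof.
elim: U t => [i|o p l IHl r IHr] t /=.
  move=> _ /andP[t0 t1]; exists (Leaf (i, t)); split=> //=.
    by rewrite /leaf_probs_ok /= !ltW.
  by exists 0; rewrite /leaf_sum big_seq1 add0r.
case/and3P=> /andP[p0 p1] wl wr /andP[t0 t1].
(* For [o = true] it is the complements of [a] and [b] that share [1 - t] in the ratio [p : 1 - p]. *)
pose a := if o then 1 - p * (1 - t) else p * t.
pose b := if o then 1 - (1 - p) * (1 - t) else (1 - p) * t.
have a01 : 0 < a < 1 by rewrite /a; case: (o); nra.
have b01 : 0 < b < 1 by rewrite /b; case: (o); nra.
have [dl [sl rl okl [kl suml]]] := IHl a wl a01.
have [dr [sr rr okr [kr sumr]]] := IHr b wr b01.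
have abE : a + b = if o then 1 + t else t by rewrite /a /b; case: (o); ring.
have cmp : (a + b <= 1) = ~~ o.
  by rewrite abE; case: (o); apply/idP/idP => //; lra.
exists (Node dl dr); split=> /=.
- rewrite sl sr rl rr /win_prob cmp negbK; congr SNode.
  rewrite -[2 - a - b]addrA -opprD abE /a; case: (o) => /=; field; lra.
- by rewrite rl rr cmp abE; case: (o) => //=; ring.
- by move: okl okr; rewrite /leaf_probs_ok /= all_cat => -> ->.
- exists (kl + kr + o)%N; rewrite leaf_sum_node suml sumr !natrD.
  by rewrite addrACA abE; case: (o) => /=; ring.
Qed.

Definition outcome_genfun x d := genfun x (skeleton_of d) (root_prob d == 1).

(** If [b = o], both children have the decided outcome [o] and the tree splits. Otherwise exactly
    one of the two pending indices is accepted, whatever [o] is, and a single tree does this. *)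
Lemma realize_outcome (U : skeleton) (b : bool) :
  all_weights proper_weight U ->
  exists ds : seq (tree (I * R)),
    [/\ forall d, List.In d ds -> valid_tree d,
        flatten [seq map fst (leaves d) | d <- ds] = sleaves U &
        forall x, \prod_(d <- ds) outcome_genfun x d = genfun x U b].
Proof.
elim: U b => [i|o p l IHl r IHr] b /=.
  move=> _; exists [:: Leaf (i, b%:R)]; split=> // [_ [<-|//]|x].
    split; first by rewrite /leaf_probs_ok /= ler0n lern1 leq_b1.
    by exists b; rewrite /leaf_sum big_seq1.
  by rewrite big_seq1 /outcome_genfun /=; case: b; rewrite ?eqxx // eq_sym oner_eq0.
case/and3P=> p01 wl wr; have [bo|bo] := eqVneq b o.
  have [ds1 [v1 l1 g1]] := IHl o wl; have [ds2 [v2 l2 g2]] := IHr o wr.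
  exists (ds1 ++ ds2); split.
  - by move=> d /List.in_app_iff[/v1|/v2].
  - by rewrite map_cat flatten_cat l1 l2.
  - by move=> x; rewrite big_cat /= g1 g2.
(* Root probabilities summing to exactly 1 make the node decide between the two subtrees. *)
pose a := if o then 1 - p else p.
have a01 : 0 < a < 1 by rewrite /a; case: (o); move: p01; rewrite /proper_weight; lra.
have b01 : 0 < 1 - a < 1 by lra.
have [dl [sl rl okl [kl suml]]] := realize_skeleton l a wl a01.
have [dr [sr rr okr [kr sumr]]] := realize_skeleton r (1 - a) wr b01.
have aE : a + (1 - a) = 1 by ring.
exists [:: Node dl dr]; split=> [_ [<-|//]| |x].
- split; first by move: okl okr; rewrite /leaf_probs_ok /= all_cat => -> ->.
  by exists (kl + kr + 1)%N; rewrite leaf_sum_node suml sumr !natrD -[X in _ = _ + X]aE; ring.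
- by rewrite /= cats0 map_cat -!sleaves_skeleton_of sl sr.
- rewrite big_seq1 /outcome_genfun /= sl sr rl rr aE lexx eqxx /=.
  rewrite /win_prob aE lexx divr1 /a.
  by case: (o); rewrite /=; ring.
Qed.

Lemma realize_forest (F : forest) : fproper F ->
  exists ds : seq (tree (I * R)),
    [/\ forall d, List.In d ds -> valid_tree d,
        flatten [seq map fst (leaves d) | d <- ds] = fleaves F &
        forall x, \prod_(d <- ds) outcome_genfun x d = fgenfun x F].
Proof.
elim: F => [_|f F IH /= /andP[wf /IH[ds [v lv g]]]].
  by exists [::]; split=> // x; rewrite /fgenfun !big_nil.
have [ds1 [v1 l1 g1]] := realize_outcome f.2 f.1 wf.
exists (ds1 ++ ds); split.
- by move=> d /List.in_app_iff[/v1|/v].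
- by rewrite map_cat flatten_cat l1 lv.
- by move=> x; rewrite big_cat /= g1 g /fgenfun big_cons.
Qed.

End WeightedTrees.

(** * From runs of the process to generating functions *)

Section Runs.
Context {R : realType} {n : nat}.
Implicit Types (q : 'I_n -> R) (T : tree 'I_n) (x : bool -> 'I_n -> R).

Definition decorate q T := tree_map (fun i => (i, q i)) T.

Definition resolve (b : bool) (s : state R n) : {set 'I_n} :=
  if b then s.1.1 |: s.2 else s.2.

Definition monomial x (L : seq 'I_n) (X : {set 'I_n}) : R :=
  \prod_(k <- L) x (k \in X) k.

Lemma eq_monomial x L (X Y : {set 'I_n}) :
  {in L, X =i Y} -> monomial x L X = monomial x L Y.
Proof. by move=> XY; apply: eq_big_seq => k kL; rewrite XY. Qed.

Definition state_inv q T (s : state R n) :=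
  [&& s.1.1 \in leaves T, s.1.2 == root_prob (decorate q T)
    & s.2 \subset leaves T].

Lemma resolve_subset q T b s : state_inv q T s -> resolve b s \subset leaves T.
Proof.
case/and3P=> iT _ XT; rewrite /resolve; case: b => //.
by apply/subsetP => k; rewrite !inE => /orP[/eqP->//|/(subsetP XT)].
Qed.

(* Both kinds of step pass one index on and resolve the other one with outcome [o]. *)
Lemma mergeE (s1 s2 : state R n) :
  let o := ~~ (s1.1.2 + s2.1.2 <= 1) in
  let p := win_prob s1.1.2 s2.1.2 in
  let c := if o then s1.1.2 + s2.1.2 - 1 else s1.1.2 + s2.1.2 in
  Defs.merge s1 s2 = [:: (p, (s1.1.1, c, s1.2 :|: resolve o s2));
                    (1 - p, (s2.1.1, c, resolve o s1 :|: s2.2))].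
Proof.
case: s1 => [[i a] X1]; case: s2 => [[j b] X2] /=; rewrite /win_prob /resolve.
by case: ifP => _ //=; rewrite setUCA -setUA.
Qed.

Lemma run_state_inv q T y : y \in pivotal_run q T -> state_inv q T y.2.
Proof.
elim: T y => [i|l IHl r IHr] y /=.
  rewrite inE => /eqP-> /=; rewrite /state_inv /= mem_head eqxx.
  by apply/subsetP => k; rewrite inE.
case/flattenP => _ /allpairsP[[y1 y2] /= [/IHl inv1 /IHr inv2 ->]] /mapP[z zm ->] /=.
have [i1T /eqP a1 _] := and3P inv1; have [i2T /eqP a2 _] := and3P inv2.
have sub (X Y : {set 'I_n}) : X \subset leaves l -> Y \subset leaves r ->
    X :|: Y \subset leaves l ++ leaves r.
  move=> Xl Yr; apply/subsetP => k.
  by rewrite inE mem_cat => /orP[/(subsetP Xl)->|/(subsetP Yr)->]; rewrite ?orbT.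
move: zm; rewrite mergeE !inE => /orP[] /eqP->; rewrite /state_inv /= mem_cat.
  rewrite i1T a1 a2 if_neg eqxx /= sub //; last exact: resolve_subset inv2.
  exact: (resolve_subset _ _ false _ inv1).
rewrite i2T orbT a1 a2 if_neg eqxx /= sub //; first exact: resolve_subset inv1.
exact: (resolve_subset _ _ false _ inv2).
Qed.

Lemma monomial_cat x (L1 L2 : seq 'I_n) (X Y : {set 'I_n}) :
  ~~ has [in L1] L2 -> X \subset L1 -> Y \subset L2 ->
  monomial x (L1 ++ L2) (X :|: Y) = monomial x L1 X * monomial x L2 Y.
Proof.
move=> /hasPn dis XL YL; rewrite /monomial big_cat.
congr (_ * _); apply: eq_big_seq => k kL; rewrite inE.
  by rewrite [k \in Y](contraTF _ kL) ?orbF // => /(subsetP YL)/dis.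
by rewrite [k \in X](contraNF _ (dis k kL)) // => /(subsetP XL).
Qed.

(** Sibling subtrees run independently and have disjoint leaves, so monomials factor and the sum
    splits. *)
Lemma run_genfun q T x b : uniq (leaves T) ->
  \sum_(y <- pivotal_run q T) y.1 * monomial x (leaves T) (resolve b y.2)
  = genfun x (skeleton_of (decorate q T)) b.
Proof.
elim: T b => [i|l IHl r IHr] b /=.
  move=> _; rewrite big_seq1 /= mul1r /monomial big_seq1 /resolve.
  by case: b; rewrite !inE ?eqxx.
rewrite cat_uniq => /and3P[ul dis ur].
rewrite big_flatten /= big_allpairs_dep /=.
set p := win_prob _ _; set o := ~~ _.
pose m1 (y : R * state R n) b := y.1 * monomial x (leaves l) (resolve b y.2).
pose m2 (y : R * state R n) b := y.1 * monomial x (leaves r) (resolve b y.2).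
transitivity (\sum_(y1 <- pivotal_run q l) \sum_(y2 <- pivotal_run q r)
   (p * (m1 y1 b * m2 y2 o) + (1 - p) * (m1 y1 o * m2 y2 b))).
  apply: eq_big_seq => y1 /run_state_inv inv1; apply: eq_big_seq => y2 /run_state_inv inv2.
  rewrite big_map mergeE; have [_ /eqP-> _] := and3P inv1; have [_ /eqP-> _] := and3P inv2.
  rewrite -/o -/p !big_cons big_nil /= addr0 /m1 /m2.
  rewrite (_ : resolve b _ = resolve b y1.2 :|: resolve o y2.2); last first.
    by rewrite {1 2}/resolve; case: (b); rewrite //= setUA.
  rewrite (_ : resolve b (_, resolve o y1.2 :|: _) = resolve o y1.2 :|: resolve b y2.2); last first.
    by rewrite {1 3}/resolve; case: (b); rewrite //= setUCA.
  rewrite !monomial_cat ?(resolve_subset _ _ _ _ inv1) ?(resolve_subset _ _ _ _ inv2) //; ring.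
under eq_bigr do rewrite big_split -!mulr_sumr /=.
rewrite big_split -!mulr_sumr -!mulr_suml /= !IHl // !IHr //.
(* For [b = o] the two terms coincide and their weights sum to 1. *)
case: ifPn => [/eqP->|]; first ring.
by case: b; case: (o).
Qed.

(** Meant for events constraining each index separately, whose indicator is a monomial. *)
Lemma pivotal_prob_genfun q T x (P : pred {set 'I_n}) : uniq (leaves T) ->
  (forall X : {set 'I_n}, X \subset leaves T -> (P X)%:R = monomial x (leaves T) X) ->
  pivotal_prob q T P = outcome_genfun x (decorate q T).
Proof.
move=> uT PE; rewrite /outcome_genfun -run_genfun // /pivotal_prob /pivotal_out.
rewrite big_map big_mkcond /=; apply: eq_big_seq => -[wt [[i a] X]].
move=> /run_state_inv/and3P[/= iT /eqP-> XT].
rewrite -PE /resolve /=; last first.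
  by case: ifP => // _; apply/subsetP => k; rewrite !inE => /orP[/eqP->//|/(subsetP XT)].
by case: (P _); rewrite ?mulr1 ?mulr0.
Qed.

(** [Z] holds the indices allowed in the output, [W] those allowed outside it; an index in both is
    free. *)
Definition indicator (Z W : {set 'I_n}) (b : bool) (k : 'I_n) : R :=
  (k \in if b then Z else W)%:R.

Lemma monomial_indicator Z W L X :
  monomial (indicator Z W) L X
  = (all (fun k => k \in if k \in X then Z else W) L)%:R.
Proof.
rewrite /monomial; elim: L => [|k L IH]; first by rewrite big_nil.
by rewrite big_cons IH /indicator /= -natrM mulnb.
Qed.

Lemma prob_eq q T (C : {set 'I_n}) : uniq (leaves T) ->
  pivotal_prob q T (fun X => X == C :&: [set k in leaves T])
  = outcome_genfun (indicator C (~: C)) (decorate q T).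
Proof.
move=> uT; apply: pivotal_prob_genfun => // X XT; rewrite monomial_indicator.
congr (nat_of_bool _)%:R; apply/eqP/allP => [->k kT|CX].
  by rewrite !inE kT andbT; case: ifPn => // kC; rewrite inE.
apply/setP => k; rewrite !inE; have [kT|kT] := boolP (k \in leaves T).
  rewrite andbT; move: (CX k kT); case: ifP => _ kC; first by rewrite kC.
  by move: kC; rewrite inE => /negbTE.
by rewrite andbF; apply: contraNF kT => /(subsetP XT).
Qed.

Lemma prob_superset q T (S : {set 'I_n}) :
  uniq (leaves T) -> S \subset leaves T ->
  pivotal_prob q T (fun X => S \subset X)
  = outcome_genfun (indicator setT (~: S)) (decorate q T).
Proof.
move=> uT ST; apply: pivotal_prob_genfun => // X XT; rewrite monomial_indicator.
congr (nat_of_bool _)%:R; apply/subsetP/allP => [SX k kT|SX k kS].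
  by case: ifPn => kX; rewrite inE // (contra (SX k)).
move: (SX k (subsetP ST k kS)); case: ifP => // _; by rewrite inE kS.
Qed.

(** No index repeats across the trees, so one lookup function serves them all. *)
Lemma undecorate (ds : seq (tree ('I_n * R))) :
  uniq (flatten [seq map fst (leaves d) | d <- ds]) ->
  exists q, forall d, List.In d ds -> decorate q (tree_map fst d) = d.
Proof.
pose s := flatten [seq leaves d | d <- ds].
have -> : flatten [seq map fst (leaves d) | d <- ds] = map fst s.
  by rewrite map_flatten -map_comp.
move=> us; exists (fun i => (nth (i, 0) s (index i (map fst s))).2) => d dds.
apply: tree_map_comp_id => -[i a] iad /=.
have ias : (i, a) \in s.
  rewrite /s; elim: (ds) dds => //= d' ds' IH [->|/IH]; rewrite mem_cat ?iad //.
  by move=> ->; rewrite orbT.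
have lt_ia : (index (i, a) s < size s)%N by rewrite index_mem.
congr pair; have -> : index i (map fst s) = index (i, a) s.
  rewrite -{1}[i]/((i, a).1) -{1}(nth_index (i, 0) ias) -(nth_map _ i) //.
  by rewrite index_uniq ?size_map.
by rewrite nth_index.
Qed.

End Runs.

(** * The conditional distribution as a product over trees *)

Theorem theoremE1 (R : realType) (n : nat) (T : tree 'I_n) (q : 'I_n -> R)
    (S : {set 'I_n}) :
  perm_eq (leaves T) (enum 'I_n) ->
  valid_leaf_probs q T ->
  0 < pivotal_prob q T (fun O => S \subset O) ->
  exists (ts : seq (tree 'I_n)) (q' : 'I_n -> R),
    (forall t, List.In t ts -> valid_leaf_probs q' t) /\
    perm_eq (flatten [seq leaves t | t <- ts]) (enum (~: S)) /\
    (forall B : {set 'I_n}, B \subset ~: S ->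
       pivotal_prob q T (fun O => O == S :|: B)
         / pivotal_prob q T (fun O => S \subset O)
       = \prod_(t <- ts)
           pivotal_prob q' t (fun O => O == B :&: [set x in leaves t])).
Proof.
move=> permT [q01 _]; have uT : uniq (leaves T) by rewrite (perm_uniq permT) enum_uniq.
have memT k : k \in leaves T by rewrite (perm_mem permT) mem_enum.
have ST : S \subset leaves T by apply/subsetP.
have okT : leaf_probs_ok (decorate q T).
  by rewrite /leaf_probs_ok leaves_tree_map all_map; apply/allP => i /q01.
have [F [V [c [Fp Vp c0 perm_FV gE]]]] :=
  condition_skeleton (fun k => k \in S) _ (skeleton_of_weights _ okT).2.
rewrite prob_superset // /outcome_genfun.
set b := (_ == 1) in gE *.
have Sx (B : {set 'I_n}) : B \subset ~: S -> conditioned_on (fun k => k \in S) (indicator (S :|: B) (~: (S :|: B))).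
  move=> BS i /= iS [] /=; by rewrite /indicator !inE iS.
have S1 : conditioned_on (fun k => k \in S) (@indicator R n setT (~: S)).
  by move=> i /= iS [] /=; rewrite /indicator !inE ?iS.
rewrite gE // => pos.
have [G [Gp lG gG]] : exists G, [/\ fproper G,
    perm_eq (fleaves G) [seq i <- sleaves (skeleton_of (decorate q T)) | i \notin S] &
    forall x, fgenfun x F * ogenfun x V b = fgenfun x G].
  case: V Vp perm_FV gE pos => [A|] /= Vp perm_FV gE pos.
    exists ((b, A) :: F); split=> [|| x]; first by rewrite /fproper /= Vp.
      by rewrite -(permPr perm_FV) /fleaves /= perm_catC.
    by rewrite /fgenfun big_cons mulrC.
  (* With [V = None], positivity of the conditioning event forces [b = true], so the factor is 1. *)
  rewrite cats0 in perm_FV; exists F; split=> // x.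
  by case: (b) pos => //=; rewrite ?mulr1 // !mulr0 ltxx.
have {lG} lG : perm_eq (fleaves G) (enum (~: S)).
  rewrite (permPl lG) sleaves_skeleton_of leaves_tree_map -map_comp map_id.
  apply: uniq_perm; rewrite ?enum_uniq ?filter_uniq // => k.
  by rewrite mem_filter memT mem_enum inE andbT.
have [ds [dsv dsl dsg]] := realize_forest G Gp.
have uds : uniq (flatten [seq map fst (leaves d) | d <- ds]).
  by rewrite dsl (perm_uniq lG) enum_uniq.
have [q' dec] := undecorate ds uds.
have leavesE (d : tree ('I_n * R)) : leaves (tree_map fst d) = map fst (leaves d).
  exact: leaves_tree_map.
exists (map (tree_map fst) ds), q'; split; [|split].
- move=> _ /List.in_map_iff[d [<- dds]]; have := dsv d dds; rewrite -[X in valid_tree X](dec d dds).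
  set t := tree_map fst d; rewrite /valid_tree /leaf_probs_ok /leaf_sum /decorate.
  rewrite leaves_tree_map all_map big_map => -[/allP ok [k sumk]].
  by split; [move=> i it; exact: ok i it | exists k].
- by rewrite -map_comp (eq_map leavesE) dsl.
move=> B BS; rewrite big_map.
(* Indices outside [S] are free in the conditioning event, so its probability is exactly [c b]. *)
have G1 : fgenfun (@indicator R n setT (~: S)) G = 1.
  apply: fgenfun1 => b' i; rewrite (perm_mem lG) mem_enum /indicator => iS.
  by case: b'; rewrite ?iS ?inE.
move: pos; rewrite gG G1 mulr1 => pos.
have leavesT : [set k in leaves T] = setT by apply/setP => k; rewrite !inE memT.
have := prob_eq q T (S :|: B) uT; rewrite leavesT setIT => ->.
rewrite /outcome_genfun -/b gE ?gG; last exact: Sx.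
rewrite mulrAC divff ?lt0r_neq0 // mul1r -dsg.
have In_leaves d : List.In d ds -> uniq (map fst (leaves d)) /\ {subset map fst (leaves d) <= ~: S}.
  move=> /(List.in_split _ _)[ds1 [ds2 dsE]]; split.
    by move: uds; rewrite dsE map_cat flatten_cat /= !cat_uniq => /and3P[_ _ /and3P[]].
  move=> k kd; rewrite -mem_enum -(perm_mem lG) -dsl dsE map_cat flatten_cat /=.
  by rewrite !mem_cat kd orbT.
elim: (ds) In_leaves dec => [|d ds' IH] Hl Hd; first by rewrite !big_nil.
rewrite !big_cons -IH; first last.
- by move=> e He; apply: Hd; right.
- by move=> e He; apply: Hl; right.
congr (_ * _); have [ud dS] := Hl d (or_introl erefl).
rewrite -[in LHS](Hd d (or_introl erefl)) -prob_eq ?leaves_tree_map //.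
(* The leaves of [d] avoid [S], so [B] and [S :|: B] agree on them. *)
suff -> : B :&: [set k in map fst (leaves d)]
        = (S :|: B) :&: [set k in map fst (leaves d)] by [].
apply/setP => k; rewrite !inE.
case: (boolP (k \in map fst (leaves d))) => [/dS|]; last by rewrite !andbF.
by rewrite inE => /negbTE->.
Qed.
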